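(* Let $c\in(3/2,5/2]$. There exists a constant $\gamma\in(0,1)$, not depending on $\nu$, on $f_0$, on the fixed point or on the solution considered, such that the following holds for all $\nu>0$ and $f_0>0$. Let $\alpha\in l^2$ be a fixed point of the viscous dyadic model $$\frac{d}{dt} a_j - 2^{c(j-1)} a_{j-1}^2 + 2^{cj} a_j a_{j+1} + \nu 2^{2j} a_j = f_j,\qquad j=0,1,2,\dots,\qquad a_{-1}=0,$$ where $f_j=0$ for all $j>0$, and let $a(t)$ be a solution of this model on $[0,\infty)$ with $a(0)\in l^2$ and $a_j(0)\ge 0$ for all $j\ge 0$. Put $b(t)=a(t)-\alpha$. Then for all $t\ge 0$ $$|b(t)|^2\le |b(0)|^2 e^{-2\gamma\nu t}.$$
   Context: Sequences are real and indexed by $j=0,1,2,\dots$; $|a|^2=\sum_{j\ge0}a_j^2$ is the squared $l^2$ norm. A solution of the model on $[0,\infty)$ is an $l^2$-valued function $a(t)$ defined for $t\in[0,\infty)$ such that $a_j\in C^1([0,\infty))$ and $a_j(t)$ satisfies the $j$-th equation of the model for every $j\ge0$. A fixed point is a time-independent solution $\alpha=(\alpha_j)_{j\ge0}$, i.e. $-2^{c(j-1)}\alpha_{j-1}^2+2^{cj}\alpha_j\alpha_{j+1}+\nu2^{2j}\alpha_j=f_j$ for all $j\ge0$, with $\alpha_{-1}=0$.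
   Formalization: For c > 2 the fixed point α is additionally assumed nonnegative, because for c in (2,5/2] there is an everywhere negative l² fixed point α_j = -K 2^{(2-c)j} with f_0 > 0, to which no solution with nonnegative data converges. *)

(* Defs.v *)
From Stdlib Require Import Reals.
From Coquelicot Require Import Coquelicot.

Open Scope R_scope.

Definition in_l2 (a : nat -> R) : Prop := ex_series (fun j => a j ^ 2).

(* The squared l^2 norm; meaningful only when [in_l2 a]. *)
Definition l2_norm_sq (a : nat -> R) : R := Series (fun j => a j ^ 2).

(* a_{j-1}, with the convention a_{-1} = 0. *)
Definition prev (a : nat -> R) (j : nat) : R :=
  match j with
  | O => 0
  | S i => a i
  end.

(* The terms of the j-th equation other than the time derivative and the
   force.  The exponent c (j - 1) is a real number, equal to - c at j = 0. *)
Definition dyadic_terms (c nu : R) (a : nat -> R) (j : nat) : R :=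
  - Rpower 2 (c * (INR j - 1)) * prev a j ^ 2
  + Rpower 2 (c * INR j) * a j * a (S j)
  + nu * 2 ^ (2 * j) * a j.

Definition half_line (t : R) : Prop := 0 <= t.

(* [g] is [f'] on [0, +oo), one-sided at 0, and is continuous there.
   The values of [f] and [g] at negative times play no role. *)
Definition C1_half_line (f g : R -> R) : Prop :=
  forall t : R, 0 <= t -> D_in f g half_line t /\ continue_in g half_line t.

Definition is_solution (c nu : R) (f : nat -> R) (a : R -> nat -> R) : Prop :=
  (forall t : R, 0 <= t -> in_l2 (a t)) /\
  (forall j : nat, exists da : R -> R,
     C1_half_line (fun t => a t j) da /\
     forall t : R, 0 <= t -> da t + dyadic_terms c nu (a t) j = f j).

(* No sign is imposed.  Besides nonnegative fixed points, for 2 < c < 3 and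
   nu > 0 there is the everywhere negative l^2 fixed point
     alpha_j = - nu y 2^{(2-c)j},  where  y (2^{2-c} - 2^{c-4}) = 1,
   with force f_0 = nu^2 y (y 2^{2-c} - 1) > 0 and f_j = 0 for j > 0.  It
   attracts no solution with nonnegative data, as these remain nonnegative.
   For c <= 2 and f_0 > 0, f_j = 0 (j > 0), l^2 fixed points are positive. *)
Definition is_fixed_point (c nu : R) (f alpha : nat -> R) : Prop :=
  in_l2 alpha /\ forall j : nat, dyadic_terms c nu alpha j = f j.

(* Main.v *)
Require Import Defs.
From Stdlib Require Import Reals Lra Lia.
From Coquelicot Require Import Coquelicot.

Open Scope R_scope.

(** Write P = 2^c and b = a - alpha.  Pairing the equation for b with b, the
    terms cubic in b telescope and what is left is formally

      (1/2) d|b|^2/dt = sum_j P^j alpha_j b_j b_{j+1} - sum_j D_j b_j^2,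
      D_j = P^j alpha_{j+1} + nu 4^j.

    The fixed point equations say exactly alpha_{j+1} D_{j+1} = P^j alpha_j^2
    and alpha_0 D_0 = f_0, so that

      D_j D_{j+1} = (P^j alpha_j)^2 + nu 4^j D_{j+1}:

    the tridiagonal form above is already nonpositive, with a viscous margin.
    To turn the margin into a rate gamma nu one needs to know that D cannot
    drop sharply from one index to the next, with a constant that depends on
    nothing.  This is [damping_slow_decrease], and it comes from the instability
    of the fixed point recursion: if alpha_{j+1} > 2 alpha_j for one j, then the
    same excess recurs at j + 2, j + 4, ... and alpha grows geometrically along
    these indices, so it is not in l^2 ([growth_step], [fixed_point_ratio]).
    With D_j <= 5 D_{j+1}, replacing D_j by E_j = D_j - gamma nu 4^j keeps
    (P^j alpha_j)^2 <= E_j E_{j+1} as soon as 20 gamma <= 1 - gamma, whence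
    gamma = 1/21 ([coupling_sq_le]).

    All this uses alpha_j > 0.  For c <= 2 it follows from alpha in l^2: D_j is
    positive for large j because P^j alpha_{j+1} is o(4^j), and positivity then
    descends to smaller indices since D_j and alpha_j have the same sign.

    To make the energy computation rigorous, truncate at N.  The truncated
    identity has a boundary term.  Its part b_N^2 a_{N+1} has a favourable sign,
    as solutions with nonnegative data stay nonnegative
    ([nonneg_of_linear_inequality]).  The rest is at most
    eps_N 4^N (b_N^2 + b_{N+1}^2) up to a constant, where eps_N = s (P/8)^N:
    indeed P^N alpha_N <= s (P/8)^N 4^N because 4^N alpha_N^2 is bounded, and
    P < 8.  It need not be small at a fixed time, but it is dominated by the
    enstrophy sum_j 4^j a_j^2 of the solution, which the energy inequality for a
    itself dissipates.  So Gronwall's lemma is applied to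

      W_N = sum_{j<=N} b_j^2 + delta_N sum_{j<=N+1} a_j^2,
      delta_N = 24 eps_N / nu,

    ([truncated_lyapunov_decay]), and letting N tend to infinity at fixed t
    removes delta_N and the error terms. *)

(** * Fixed points: positivity *)

(** The coefficient multiplying u_j in the j-th equation, when u = alpha; also
    the diagonal of the quadratic form governing the difference. *)
Definition damping (P nu : R) (alpha : nat -> R) (j : nat) : R :=
  P ^ j * alpha (S j) + nu * 4 ^ j.

Definition positive_fixed_point (P nu F : R) (alpha : nat -> R) : Prop :=
  (forall j, 0 < alpha j) /\
  alpha O * damping P nu alpha O = F /\
  (forall j, alpha (S j) * damping P nu alpha (S j) = P ^ j * alpha j ^ 2).

Lemma Rpower_2_mult_INR c j : Rpower 2 (c * INR j) = Rpower 2 c ^ j.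
Proof.
  rewrite <- Rpower_mult, Rpower_pow; [reflexivity | apply exp_pos].
Qed.

Lemma pow_2_double j : 2 ^ (2 * j) = 4 ^ j.
Proof. rewrite pow_mult. f_equal. ring. Qed.

Lemma dyadic_terms_O c nu u :
  dyadic_terms c nu u O = u O * u (S O) + nu * u O.
Proof.
  unfold dyadic_terms, prev. rewrite Rpower_2_mult_INR. simpl. ring.
Qed.

Lemma dyadic_terms_S c nu u j :
  dyadic_terms c nu u (S j) =
  - Rpower 2 c ^ j * u j ^ 2 + Rpower 2 c ^ (S j) * u (S j) * u (S (S j))
  + nu * 4 ^ (S j) * u (S j).
Proof.
  unfold dyadic_terms, prev.
  replace (INR (S j) - 1) with (INR j) by (rewrite S_INR; ring).
  rewrite !Rpower_2_mult_INR, pow_2_double. ring.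
Qed.

Lemma l2_sq_lim u : in_l2 u -> is_lim_seq u 0.
Proof.
  intros H. apply ex_series_lim_0 in H.
  apply is_lim_seq_spec. apply is_lim_seq_spec in H.
  intros eps.
  assert (He : 0 < eps * eps) by (destruct eps; simpl; nra).
  destruct (H (mkposreal _ He)) as [N HN]. exists N. intros n Hn.
  specialize (HN n Hn). simpl in HN.
  destruct eps as [e Hep]; simpl in *.
  rewrite Rminus_0_r in *.
  rewrite Rabs_pos_eq in HN by nra.
  apply Rabs_def1; nra.
Qed.

Lemma l2_eventually_small u eps :
  in_l2 u -> 0 < eps -> exists N, forall n, (N <= n)%nat -> Rabs (u n) < eps.
Proof.
  intros H He. apply l2_sq_lim, is_lim_seq_spec in H.
  destruct (H (mkposreal _ He)) as [N HN]. exists N. intros n Hn.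
  specialize (HN n Hn). simpl in HN. rewrite Rminus_0_r in HN. exact HN.
Qed.

Lemma fixed_point_relations c nu f alpha :
  is_fixed_point c nu f alpha -> (forall j, (0 < j)%nat -> f j = 0) ->
  alpha O * damping (Rpower 2 c) nu alpha O = f O /\
  (forall j, alpha (S j) * damping (Rpower 2 c) nu alpha (S j)
             = Rpower 2 c ^ j * alpha j ^ 2).
Proof.
  intros [_ H] Hf. split; [|intros j].
  - rewrite <- (H O), dyadic_terms_O. unfold damping. simpl. ring.
  - assert (E := H (S j)). rewrite Hf, dyadic_terms_S in E by lia.
    unfold damping. lra.
Qed.

Lemma pos_of_mult_pos x d : 0 < d -> 0 < x * d -> 0 < x.
Proof. intros Hd H. nra. Qed.

Lemma damping_pos P nu alpha j :
  0 < P -> 0 < nu -> 0 <= alpha (S j) -> 0 < damping P nu alpha j.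
Proof.
  intros HP Hn Ha. unfold damping.
  assert (0 < P ^ j) by now apply pow_lt.
  assert (0 < 4 ^ j) by (apply pow_lt; lra). nra.
Qed.

Lemma fixed_point_nonzero P nu F alpha :
  0 < P -> 0 < F -> alpha O * damping P nu alpha O = F ->
  (forall j, alpha (S j) * damping P nu alpha (S j) = P ^ j * alpha j ^ 2) ->
  forall j, alpha j <> 0.
Proof.
  intros HP HF H0 HS j. induction j as [|j IH]; intros E.
  - rewrite E in H0. lra.
  - assert (Hj := HS j). rewrite E, Rmult_0_l in Hj.
    assert (0 < P ^ j * alpha j ^ 2).
    { apply Rmult_lt_0_compat; [now apply pow_lt|].
      assert (0 < Rsqr (alpha j)) by now apply Rlt_0_sqr.
      unfold Rsqr in *. lra. }
    lra.
Qed.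

(** For P <= 4 viscosity dominates the transport coefficient at high modes. *)
Lemma damping_eventually_pos P nu alpha :
  1 <= P <= 4 -> 0 < nu -> in_l2 alpha ->
  exists N, forall j, (N <= j)%nat -> 0 < damping P nu alpha j.
Proof.
  intros HP Hn Hl.
  destruct (l2_eventually_small alpha nu Hl Hn) as [N HN]. exists N.
  intros j Hj. specialize (HN (S j) ltac:(lia)).
  apply Rabs_def2 in HN. unfold damping.
  assert (0 < P ^ j) by (apply pow_lt; lra).
  assert (P ^ j <= 4 ^ j) by (apply pow_incr; lra). nra.
Qed.

(** The product alpha_j D_j is always positive, so alpha_j has the sign of D_j,
    and D_j is positive when alpha_{j+1} is: positivity propagates downwards
    from high modes. *)
Lemma fixed_point_positive P nu F alpha :
  1 <= P -> 0 < nu -> 0 < F -> in_l2 alpha ->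
  alpha O * damping P nu alpha O = F ->
  (forall j, alpha (S j) * damping P nu alpha (S j) = P ^ j * alpha j ^ 2) ->
  (4 < P -> forall j, 0 <= alpha j) ->
  positive_fixed_point P nu F alpha.
Proof.
  intros HP Hn HF Hl H0 HS Hs. split; [|split; assumption].
  assert (Hnz : forall j, alpha j <> 0)
    by (apply (fixed_point_nonzero P nu F); trivial; lra).
  destruct (Rlt_or_le 4 P) as [H4|H4].
  { intros j. specialize (Hs H4 j). specialize (Hnz j). lra. }
  assert (Hback : forall j, 0 < damping P nu alpha j -> 0 < alpha j).
  { intros j Hd. apply (pos_of_mult_pos _ _ Hd). destruct j as [|j].
    - now rewrite H0.
    - rewrite HS. apply Rmult_lt_0_compat; [apply pow_lt; lra|].
      specialize (Hnz j). simpl. rewrite Rmult_1_r. nra. }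
  destruct (damping_eventually_pos P nu alpha) as [N HN]; trivial; [lra|].
  assert (Hdown : forall k j, (N <= j + k)%nat -> 0 < alpha j).
  { induction k as [|k IH]; intros j Hj; apply Hback.
    - apply HN. lia.
    - apply damping_pos; [lra | lra |]. apply Rlt_le, IH. lia. }
  intros j. apply (Hdown N). lia.
Qed.

(** * Fixed points: the ratio of consecutive modes *)

(** One round of the instability.  Here x, y, z, w are consecutive modes, p is
    P^j and n is nu 4^j.  If y is large compared with x, the first equation
    makes both z and the viscosity small; the second one, whose right side is
    quadratic in y, must then be balanced by a large w. *)
Lemma growth_step P p n x y z w :
  1 <= P -> 0 < p -> 0 < n -> 0 < x -> 0 < y -> 0 < z -> 0 < w ->
  y * (P * p * z + 4 * n) = p * x ^ 2 ->
  z * (P * (P * p) * w + 16 * n) = P * p * y ^ 2 ->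
  2 * x < y -> 2 * y <= w /\ 2 * z < w.
Proof.
  intros HP Hp Hn Hx Hy Hz Hw E1 E2 Hxy.
  assert (E1' : y * (P * z + 4 * (n / p)) = x ^ 2).
  { apply (Rmult_eq_reg_l p); [|lra]. rewrite <- E1. field. lra. }
  assert (E2' : z * (P * P * w + 16 * (n / p)) = P * y ^ 2).
  { apply (Rmult_eq_reg_l p); [|lra].
    replace (p * (P * y ^ 2)) with (P * p * y ^ 2) by ring.
    rewrite <- E2. field. lra. }
  assert (Hm : 0 < n / p) by now apply Rdiv_lt_0_compat.
  set (m := n / p) in *. clearbody m. clear E1 E2 Hn Hp n p.
  assert (HPz : 0 < P * z) by nra.
  assert (A : 2 * (P * z + 4 * m) < x) by nra.
  assert (Hz' : z <= P * z) by nra.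
  assert (B : 2 * y <= w).
  { destruct (Rle_or_lt (2 * y) w) as [h|h]; trivial. exfalso.
    assert (C1 : (P * z) * (P * w) <= x / 2 * (P * (2 * y))).
    { apply Rmult_le_compat; nra. }
    assert (C2 : 16 * m * z <= x * x) by nra.
    assert (C3 : P * x * y <= P * y ^ 2 / 2).
    { assert (x * y <= y ^ 2 / 2) by nra. nra. }
    assert (C4 : 4 * (x * x) <= y ^ 2) by nra.
    assert (C5 : y ^ 2 <= P * y ^ 2) by nra.
    assert (0 < y ^ 2) by nra. nra. }
  split; lra.
Qed.

(** Otherwise [growth_step] iterates along every other index, and the modes
    S (2 k + j) stay above alpha_{j+1} > 0, which square summability forbids. *)
Lemma fixed_point_ratio P nu F alpha :
  1 <= P -> 0 < nu -> in_l2 alpha -> positive_fixed_point P nu F alpha ->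
  forall j, alpha (S j) <= 2 * alpha j.
Proof.
  intros HP Hn Hl (Hpos & _ & HS) j.
  destruct (Rle_or_lt (alpha (S j)) (2 * alpha j)) as [h|h]; trivial. exfalso.
  assert (Hstep : forall k, 2 * alpha k < alpha (S k) ->
     2 * alpha (S k) <= alpha (S (S (S k)))
     /\ 2 * alpha (S (S k)) < alpha (S (S (S k)))).
  { intros k Hk.
    assert (E1 := HS k). assert (E2 := HS (S k)). unfold damping in E1, E2.
    simpl pow in E1, E2.
    apply (growth_step P (P ^ k) (nu * 4 ^ k) (alpha k)); trivial.
    - apply pow_lt; lra.
    - apply Rmult_lt_0_compat; [lra | apply pow_lt; lra].
    - simpl. rewrite <- E1. ring.
    - simpl. rewrite <- E2. ring. }
  assert (Hk : forall k, 2 * alpha (2 * k + j)%nat < alpha (S (2 * k + j))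
                         /\ alpha (S j) <= alpha (S (2 * k + j))).
  { induction k as [|k [IH1 IH2]].
    - simpl. lra.
    - replace (2 * S k + j)%nat with (S (S (2 * k + j))) by lia.
      destruct (Hstep _ IH1). specialize (Hpos (S (2 * k + j))). lra. }
  destruct (l2_eventually_small alpha (alpha (S j)) Hl (Hpos _)) as [N HN].
  destruct (Hk N) as [_ H2].
  specialize (HN (S (2 * N + j)) ltac:(lia)).
  apply Rabs_def2 in HN. lra.
Qed.

(** * Coercivity of the linearized energy form *)

(** The part of the damping left for the coupling terms once the rate
    gamma nu 4^j, with gamma = 1/21, is set aside. *)
Definition reduced_damping (P nu : R) (alpha : nat -> R) (j : nat) : R :=
  damping P nu alpha j - / 21 * nu * 4 ^ j.

(** From alpha_{j+1} D_{j+1} = P^j alpha_j^2 and alpha_{j+1} <= 2 alpha_j one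
    gets P^j alpha_{j+1} <= 4 D_{j+1}; the viscous part of D_j is a quarter of
    that of D_{j+1}. *)
Lemma damping_slow_decrease P nu F alpha :
  1 <= P -> 0 < nu -> in_l2 alpha -> positive_fixed_point P nu F alpha ->
  forall j, damping P nu alpha j <= 5 * damping P nu alpha (S j).
Proof.
  intros HP Hn Hl Hfp j.
  assert (Hr := fixed_point_ratio P nu F alpha HP Hn Hl Hfp j).
  destruct Hfp as (Hpos & _ & HS). assert (E := HS j).
  assert (Hx := Hpos j). assert (Hy := Hpos (S j)). assert (Hz := Hpos (S (S j))).
  assert (Hp : 0 < P ^ j) by (apply pow_lt; lra).
  assert (Hp' : 0 < P ^ S j) by (apply pow_lt; lra).
  assert (Hv : nu * 4 ^ S j <= damping P nu alpha (S j)) by (unfold damping; nra).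
  set (D := damping P nu alpha (S j)) in *. clearbody D.
  unfold damping. simpl in Hv.
  assert (HD : P ^ j * alpha (S j) <= 4 * D).
  { apply (Rmult_le_reg_l (alpha (S j))); trivial.
    replace (alpha (S j) * (4 * D)) with (4 * (alpha (S j) * D)) by ring.
    rewrite E.
    replace (alpha (S j) * (P ^ j * alpha (S j)))
      with (P ^ j * alpha (S j) ^ 2) by ring.
    replace (4 * (P ^ j * alpha j ^ 2)) with (P ^ j * (2 * alpha j) ^ 2) by ring.
    apply Rmult_le_compat_l; [lra|]. apply pow_incr. lra. }
  assert (0 < nu * 4 ^ j) by (apply Rmult_lt_0_compat; [lra | apply pow_lt; lra]).
  lra.
Qed.

Lemma reduced_damping_pos P nu alpha j :
  0 < P -> 0 < nu -> 0 < alpha (S j) -> 0 < reduced_damping P nu alpha j.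
Proof.
  intros HP Hn Ha. unfold reduced_damping, damping.
  assert (0 < P ^ j) by now apply pow_lt.
  assert (0 < 4 ^ j) by (apply pow_lt; lra). nra.
Qed.

(** Without the reduction the right side exceeds the left by nu 4^j D_{j+1}.
    Reducing costs at most gamma nu 4^j D_{j+1} + 4 gamma nu 4^j D_j, up to the
    positive product of the reductions, and D_j <= 5 D_{j+1} makes this
    21 gamma nu 4^j D_{j+1}. *)
Lemma coupling_sq_le P nu F alpha :
  1 <= P -> 0 < nu -> in_l2 alpha -> positive_fixed_point P nu F alpha ->
  forall j, (P ^ j * alpha j) ^ 2
    <= reduced_damping P nu alpha j * reduced_damping P nu alpha (S j).
Proof.
  intros HP Hn Hl Hfp j.
  assert (Hs := damping_slow_decrease P nu F alpha HP Hn Hl Hfp j).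
  destruct Hfp as (Hpos & _ & HS). assert (E := HS j).
  assert (Hq : 0 < nu * 4 ^ j)
    by (apply Rmult_lt_0_compat; [lra | apply pow_lt; lra]).
  unfold reduced_damping.
  assert (E' : (P ^ j * alpha j) ^ 2
     = (damping P nu alpha j - nu * 4 ^ j) * damping P nu alpha (S j)).
  { transitivity (P ^ j * (P ^ j * alpha j ^ 2)); [ring|].
    rewrite <- E. unfold damping at 2. ring. }
  rewrite E'. simpl pow.
  set (D := damping P nu alpha j) in *.
  set (D' := damping P nu alpha (S j)) in *.
  set (v := nu * 4 ^ j) in *.
  replace (/ 21 * nu * 4 ^ j) with (/ 21 * v) by (unfold v; ring).
  replace (/ 21 * nu * (4 * 4 ^ j)) with (4 / 21 * v) by (unfold v; field).
  nra.
Qed.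

Lemma AMGM_weighted k d e x y :
  0 <= d -> 0 <= e -> k ^ 2 <= d * e ->
  2 * (k * (x * y)) <= d * x ^ 2 + e * y ^ 2.
Proof.
  intros Hd He Hk.
  assert (A : (2 * (k * (x * y))) ^ 2 <= (d * x ^ 2 + e * y ^ 2) ^ 2).
  { assert (0 <= (d * x ^ 2 - e * y ^ 2) ^ 2) by apply pow2_ge_0.
    assert (0 <= (x * y) ^ 2) by apply pow2_ge_0.
    assert (k ^ 2 * (x * y) ^ 2 <= d * e * (x * y) ^ 2) by nra. nra. }
  assert (0 <= d * x ^ 2) by (apply Rmult_le_pos; [lra|apply pow2_ge_0]).
  assert (0 <= e * y ^ 2) by (apply Rmult_le_pos; [lra|apply pow2_ge_0]).
  apply Rnot_lt_le. intros h. nra.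
Qed.

(** * Truncated energy estimates *)

Definition energy (u : nat -> R) (N : nat) : R := sum_f_R0 (fun j => u j ^ 2) N.
Definition enstrophy (u : nat -> R) (N : nat) : R :=
  sum_f_R0 (fun j => 4 ^ j * u j ^ 2) N.

(** Energy balance of the fixed point: the outgoing flux
    P^N alpha_N^2 alpha_{N+1} is positive, so the force bounds the enstrophy
    uniformly in N. *)
Lemma fixed_point_enstrophy P nu F alpha :
  0 < P -> 0 < nu -> positive_fixed_point P nu F alpha ->
  forall N, nu * enstrophy alpha N <= F * alpha O.
Proof.
  intros HP Hn (Hpos & H0 & HS) N.
  assert (A : nu * enstrophy alpha N + P ^ N * alpha N ^ 2 * alpha (S N)
              = F * alpha O).
  { unfold enstrophy. induction N as [|N IH].
    - simpl. rewrite <- H0. unfold damping. simpl. ring.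
    - rewrite <- IH. rewrite tech5, Rmult_plus_distr_l, <- (HS N).
      unfold damping. ring. }
  assert (0 < P ^ N) by now apply pow_lt.
  assert (0 < P ^ N * alpha N ^ 2 * alpha (S N)).
  { apply Rmult_lt_0_compat; trivial.
    apply Rmult_lt_0_compat; [trivial | now apply pow_lt]. }
  lra.
Qed.

Lemma energy_le_enstrophy u N : energy u N <= enstrophy u N.
Proof.
  apply sum_Rle. intros j _.
  assert (1 <= 4 ^ j) by (apply pow_R1_Rle; lra).
  assert (0 <= u j ^ 2) by apply pow2_ge_0. nra.
Qed.

Lemma enstrophy_nonneg u N : 0 <= enstrophy u N.
Proof.
  apply cond_pos_sum. intros j. apply Rmult_le_pos; [|apply pow2_ge_0].
  apply pow_le; lra.
Qed.

Lemma last_two_le_enstrophy u N :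
  4 ^ N * u N ^ 2 + 4 ^ S N * u (S N) ^ 2 <= enstrophy u (S N).
Proof.
  unfold enstrophy. rewrite tech5. destruct N as [|N]; [simpl; lra|].
  rewrite tech5. assert (H := enstrophy_nonneg u N). unfold enstrophy in H. lra.
Qed.

(** Truncated energy inequality for the difference, where du stands for the time
    derivative of u.  The first term on the right is the half of the reduced
    damping at mode N kept in store for the coupling with mode N + 1: it makes
    the induction close, each step spending one half on either side of the
    coupling.  The last term is the exact flux through mode N. *)
Lemma difference_energy_truncated P nu F alpha (u du : nat -> R) :
  1 <= P -> 0 < nu -> in_l2 alpha -> positive_fixed_point P nu F alpha ->
  du O = F - u O * u (S O) - nu * u O ->
  (forall j, du (S j) = P ^ j * u j ^ 2 - P ^ S j * u (S j) * u (S (S j))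
                        - nu * 4 ^ S j * u (S j)) ->
  forall N,
  sum_f_R0 (fun j => (u j - alpha j) * du j) N
  + / 21 * nu * enstrophy (fun j => u j - alpha j) N
  <= - / 2 * reduced_damping P nu alpha N * (u N - alpha N) ^ 2
     + P ^ N * alpha (S N) * (u N - alpha N) ^ 2
     - P ^ N * (u N * u (S N) - alpha N * alpha (S N)) * (u N - alpha N).
Proof.
  intros HP Hn Hl Hfp E0 ES N.
  assert (Hc := coupling_sq_le P nu F alpha HP Hn Hl Hfp).
  destruct Hfp as (Hpos & H0 & HS).
  assert (He : forall j, 0 < reduced_damping P nu alpha j)
    by (intros j; apply reduced_damping_pos; trivial; lra).
  unfold enstrophy. induction N as [|N IH].
  - simpl sum_f_R0. rewrite E0, <- H0. specialize (He O).
    assert (B : 0 <= reduced_damping P nu alpha O * (u O - alpha O) ^ 2)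
      by (apply Rmult_le_pos; [lra | apply pow2_ge_0]).
    unfold reduced_damping, damping in *. simpl in *. lra.
  - rewrite !tech5.
    assert (B := AMGM_weighted (P ^ N * alpha N) _ _ (u N - alpha N)
      (u (S N) - alpha (S N)) (Rlt_le _ _ (He N)) (Rlt_le _ _ (He (S N))) (Hc N)).
    assert (E : du (S N) =
      P ^ N * (u N ^ 2 - alpha N ^ 2)
      - P ^ S N * (u (S N) * u (S (S N)) - alpha (S N) * alpha (S (S N)))
      - nu * 4 ^ S N * (u (S N) - alpha (S N))).
    { assert (E' := HS N). rewrite ES. unfold damping in E'. lra. }
    rewrite E.
    (* The left side is the coupling term P^N alpha_N b_N b_{N+1} minus half of
       E_N b_N^2: the terms cubic in b cancel. *)
    assert (X : - / 2 * reduced_damping P nu alpha N * (u N - alpha N) ^ 2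
     + P ^ N * alpha (S N) * (u N - alpha N) ^ 2
     - P ^ N * (u N * u (S N) - alpha N * alpha (S N)) * (u N - alpha N)
     + P ^ N * (u N ^ 2 - alpha N ^ 2) * (u (S N) - alpha (S N))
     <= / 2 * reduced_damping P nu alpha (S N) * (u (S N) - alpha (S N)) ^ 2).
    { lra. }
    assert (Y : reduced_damping P nu alpha (S N)
      = P ^ S N * alpha (S (S N)) + nu * 4 ^ S N - / 21 * nu * 4 ^ S N)
      by reflexivity.
    rewrite Y in *. lra.
Qed.

(** Nonnegativity gives the energy flux through mode N its sign. *)
Lemma energy_balance P nu F (u du : nat -> R) :
  0 <= P -> (forall j, 0 <= u j) ->
  du O = F - u O * u (S O) - nu * u O ->
  (forall j, du (S j) = P ^ j * u j ^ 2 - P ^ S j * u (S j) * u (S (S j))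
                        - nu * 4 ^ S j * u (S j)) ->
  forall N,
  sum_f_R0 (fun j => u j * du j) N <= F * u O - nu * enstrophy u N.
Proof.
  intros HP Hu E0 ES N.
  assert (A : sum_f_R0 (fun j => u j * du j) N
    = F * u O - nu * enstrophy u N - P ^ N * u N ^ 2 * u (S N)).
  { unfold enstrophy. induction N as [|N IH].
    - simpl. rewrite E0. ring.
    - rewrite !tech5, IH, ES. ring. }
  assert (0 <= P ^ N * u N ^ 2 * u (S N)).
  { apply Rmult_le_pos; trivial.
    apply Rmult_le_pos; [now apply pow_le | apply pow2_ge_0]. }
  lra.
Qed.

(** The factor 24 eps / nu is chosen so that half of what the force leaves of
    the dissipation of u absorbs the boundary term of the difference; the other
    half provides the decay of the added energy itself.  The last line is the level below which
    the functional is no longer forced to decrease: it is of order eps. *)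
Lemma truncated_lyapunov_decay P nu F alpha (u du : nat -> R) N eps C :
  1 <= P -> 0 < nu -> in_l2 alpha -> positive_fixed_point P nu F alpha ->
  (forall j, 0 <= u j) ->
  du O = F - u O * u (S O) - nu * u O ->
  (forall j, du (S j) = P ^ j * u j ^ 2 - P ^ S j * u (S j) * u (S (S j))
                        - nu * 4 ^ S j * u (S j)) ->
  P ^ N * alpha N <= eps * 4 ^ N ->
  enstrophy alpha (S N) <= C ->
  2 * sum_f_R0 (fun j => (u j - alpha j) * du j) N
  + 24 * eps / nu * (2 * sum_f_R0 (fun j => u j * du j) (S N))
  <= - (2 * / 21 * nu) *
       (energy (fun j => u j - alpha j) N + 24 * eps / nu * energy u (S N)
        - 21 * eps * (6 * C / nu + 12 * F ^ 2 / nu ^ 3)).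
Proof.
  intros HP Hn Hl Hfp Hu E0 ES Heps HC.
  assert (A := difference_energy_truncated P nu F alpha u du HP Hn Hl Hfp E0 ES N).
  assert (B := energy_balance P nu F u du ltac:(lra) Hu E0 ES (S N)).
  assert (Hr := fixed_point_ratio P nu F alpha HP Hn Hl Hfp N).
  destruct Hfp as (Hpos & _ & _).
  assert (Hp : 0 < P ^ N) by (apply pow_lt; lra).
  assert (Hq : 0 < 4 ^ N) by (apply pow_lt; lra).
  assert (Hk : 0 < P ^ N * alpha N) by now apply Rmult_lt_0_compat.
  assert (Heps0 : 0 < eps) by nra.
  assert (He := reduced_damping_pos P nu alpha N ltac:(lra) Hn (Hpos _)).
  assert (Hu2 := last_two_le_enstrophy u N).
  assert (Ha2 := last_two_le_enstrophy alpha N).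
  assert (Hb := energy_le_enstrophy (fun j => u j - alpha j) N).
  assert (Hub := energy_le_enstrophy u (S N)).
  assert (Hu0 : u O ^ 2 <= enstrophy u (S N)).
  { unfold enstrophy. rewrite decomp_sum by lia. simpl pred.
    assert (0 <= sum_f_R0 (fun i => 4 ^ S i * u (S i) ^ 2) N).
    { apply cond_pos_sum. intros j. apply Rmult_le_pos; [|apply pow2_ge_0].
      apply pow_le; lra. }
    simpl pow in *. lra. }
  set (V := enstrophy u (S N)) in *.
  set (Ea := enstrophy alpha (S N)) in *.
  set (S1 := sum_f_R0 (fun j => (u j - alpha j) * du j) N) in *.
  set (S2 := sum_f_R0 (fun j => u j * du j) (S N)) in *.
  (* Half of the dissipation pays for the work of the force. *)
  assert (B' : S2 <= - (nu / 2) * V + F ^ 2 / (2 * nu)).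
  { assert (F * u O <= nu / 2 * u O ^ 2 + F ^ 2 / (2 * nu)).
    { apply Rminus_le_0.
      replace (nu / 2 * u O ^ 2 + F ^ 2 / (2 * nu) - F * u O)
        with ((nu * u O - F) ^ 2 * / (2 * nu)) by (field; lra).
      apply Rmult_le_pos; [apply pow2_ge_0|].
      apply Rlt_le, Rinv_0_lt_compat; lra. }
    nra. }
  assert (A' : S1 + / 21 * nu * energy (fun j => u j - alpha j) N
               <= 6 * eps * (V + C)).
  (* In G, x and z are b_N and b_{N+1}, y and w are P^N and u_{N+1}, k and k' are
     the weights P^N alpha_N and P^N alpha_{N+1}, and e is E_N. *)
  { assert (G : forall x y z w k k' e : R, 0 <= y -> 0 <= e -> 0 < k ->
      0 < k' <= 2 * k ->
      - / 2 * e * x ^ 2 + k' * x ^ 2 - k * (z * x) - y * x ^ 2 * w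
      <= 3 * k * (x ^ 2 + z ^ 2) - y * x ^ 2 * w).
    { intros x y z w k k' e Hy He' Hk0 Hk'.
      assert (0 <= x ^ 2) by apply pow2_ge_0.
      assert (0 <= z ^ 2) by apply pow2_ge_0.
      assert (- (z * x) <= / 2 * x ^ 2 + / 2 * z ^ 2)
        by (assert (0 <= (x + z) ^ 2) by apply pow2_ge_0; lra).
      assert (0 <= e * x ^ 2) by now apply Rmult_le_pos.
      assert (k' * x ^ 2 <= 2 * k * x ^ 2) by (apply Rmult_le_compat_r; lra).
      assert (k * - (z * x) <= k * (/ 2 * x ^ 2 + / 2 * z ^ 2))
        by (apply Rmult_le_compat_l; lra).
      assert (0 <= k * z ^ 2) by (apply Rmult_le_pos; lra).
      assert (0 <= k * x ^ 2) by (apply Rmult_le_pos; lra). lra. }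
    assert (G1 := G (u N - alpha N) (P ^ N) (u (S N) - alpha (S N)) (u (S N))
      (P ^ N * alpha N) (P ^ N * alpha (S N)) (reduced_damping P nu alpha N)
      ltac:(lra) ltac:(lra) Hk
      ltac:(split; [apply Rmult_lt_0_compat; trivial | nra])).
    assert (G2 : 0 <= P ^ N * (u N - alpha N) ^ 2 * u (S N)).
    { apply Rmult_le_pos; trivial.
      apply Rmult_le_pos; [lra | apply pow2_ge_0]. }
    assert (G3 : 3 * (P ^ N * alpha N) *
        ((u N - alpha N) ^ 2 + (u (S N) - alpha (S N)) ^ 2)
      <= 6 * eps * (V + C)).
    { assert (Hsq : forall x y : R, (x - y) ^ 2 <= 2 * x ^ 2 + 2 * y ^ 2)
        by (intros x y; assert (0 <= (x + y) ^ 2) by apply pow2_ge_0; lra).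
      assert (K1 := Hsq (u N) (alpha N)).
      assert (K2 := Hsq (u (S N)) (alpha (S N))).
      simpl (4 ^ S N) in *.
      assert (K3 : 4 ^ N * ((u N - alpha N) ^ 2 + (u (S N) - alpha (S N)) ^ 2)
                   <= 2 * (V + C)).
      { assert (0 <= u (S N) ^ 2) by apply pow2_ge_0.
        assert (0 <= alpha (S N) ^ 2) by apply pow2_ge_0. nra. }
      set (d := (u N - alpha N) ^ 2 + (u (S N) - alpha (S N)) ^ 2) in *.
      assert (0 <= d) by (assert (h1 := pow2_ge_0 (u N - alpha N));
        assert (h2 := pow2_ge_0 (u (S N) - alpha (S N))); unfold d; lra).
      assert (P ^ N * alpha N * d <= eps * 4 ^ N * d)
        by now apply Rmult_le_compat_r.
      nra. }
    assert (/ 21 * nu * energy (fun j => u j - alpha j) N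
      <= / 21 * nu * enstrophy (fun j => u j - alpha j) N)
      by (apply Rmult_le_compat_l; lra).
    lra. }
  assert (Hd : 0 < 24 * eps / nu) by (apply Rdiv_lt_0_compat; lra).
  assert (B2 : 24 * eps / nu * S2
     <= - 12 * eps * V + 12 * eps * F ^ 2 / nu ^ 2).
  { replace (- 12 * eps * V + 12 * eps * F ^ 2 / nu ^ 2)
      with (24 * eps / nu * (- (nu / 2) * V + F ^ 2 / (2 * nu)))
      by (field; lra).
    apply Rmult_le_compat_l; lra. }
  assert (B3 : eps * energy u (S N) <= eps * V)
    by (apply Rmult_le_compat_l; lra).
  assert (B4 : 0 <= eps * V)
    by (apply Rmult_le_pos; [lra | apply enstrophy_nonneg]).
  replace (- (2 * / 21 * nu) *
       (energy (fun j => u j - alpha j) N + 24 * eps / nu * energy u (S N)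
        - 21 * eps * (6 * C / nu + 12 * F ^ 2 / nu ^ 3)))
    with (- 2 * (/ 21 * nu * energy (fun j => u j - alpha j) N)
          - 16 / 7 * (eps * energy u (S N))
          + 12 * eps * C + 2 * (12 * eps * F ^ 2 / nu ^ 2)) by (field; lra).
  lra.
Qed.

(** * Calculus on the half line *)

(** Freezing f at f 0 for negative times gives a function continuous on the whole
    line, to which the two-sided mean value and extreme value theorems apply. *)
Lemma continuity_half_line_extension f df :
  (forall t, 0 <= t -> D_in f df half_line t) ->
  forall t, continuity_pt (fun s => f (Rmax 0 s)) t.
Proof.
  intros H t eps Heps.
  destruct (cont_deriv _ _ _ _ (H (Rmax 0 t) (Rmax_l _ _)) eps Heps)
    as (d & Hd & Hc).
  exists d. split; trivial. intros s [_ Hs]. simpl in *. unfold Rdist in *.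
  destruct (Req_dec (Rmax 0 s) (Rmax 0 t)) as [E|E].
  - rewrite E, Rminus_diag, Rabs_R0. trivial.
  - apply Hc. split.
    + split; [apply Rmax_l | congruence].
    + revert Hs. unfold Rmax, Rabs.
      repeat destruct Rle_dec; repeat destruct Rcase_abs; lra.
Qed.

Lemma D_in_half_line_is_derive f df t :
  0 < t -> D_in f df half_line t -> is_derive f t (df t).
Proof.
  intros Ht H. apply is_derive_Reals, derivable_pt_lim_D_in.
  intros eps Heps. destruct (H eps Heps) as (d & Hd & Hc).
  exists (Rmin d t). split; [now apply Rmin_glb_lt|].
  intros x [[_ Hx] Hdist]. apply Hc.
  simpl in *. unfold Rdist in *.
  assert (h1 := Rmin_l d t). assert (h2 := Rmin_r d t).
  assert (Ha := Rabs_def2 _ _ Hdist).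
  repeat split; trivial; unfold half_line; lra.
Qed.

Lemma half_line_nonincreasing f df T :
  (forall t, 0 <= t -> D_in f df half_line t) ->
  (forall t, 0 <= t <= T -> df t <= 0) -> 0 <= T -> f T <= f 0.
Proof.
  intros Hf Hd HT.
  destruct (MVT_gen (fun s => f (Rmax 0 s)) 0 T df) as (x & Hx & E).
  - rewrite Rmin_left, Rmax_right by lra. intros x Hx.
    apply (is_derive_ext_loc f).
    + exists (mkposreal x (proj1 Hx)). intros y Hy.
      apply Rabs_def2 in Hy. unfold minus, plus, opp in Hy. simpl in Hy.
      rewrite Rmax_right by lra. reflexivity.
    + apply D_in_half_line_is_derive; [tauto | apply Hf; lra].
  - intros x _. now apply (continuity_half_line_extension f df).
  - rewrite Rmin_left, Rmax_right in Hx by lra.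
    rewrite (Rmax_left 0 0), (Rmax_right 0 T) in E by lra.
    specialize (Hd x Hx). nra.
Qed.

(** The sign of k is free: decay rates and growth rates are both used. *)
Lemma gronwall_half_line W dW k T :
  (forall t, 0 <= t -> D_in W dW half_line t) ->
  (forall t, 0 <= t <= T -> dW t <= - k * W t) -> 0 <= T ->
  W T <= W 0 * exp (- k * T).
Proof.
  intros HW Hd HT.
  assert (He : forall t,
    D_in (fun s => exp (k * s)) (fun s => k * exp (k * s)) half_line t).
  { intros t. apply (D_in_imp _ _ no_cond); [easy|].
    apply derivable_pt_lim_D_in, is_derive_Reals. auto_derive; trivial. ring. }
  assert (A := half_line_nonincreasing _ _ T
    (fun t Ht => Dmult _ _ _ _ _ t (HW t Ht) (He t))).
  cbv beta in A. rewrite Rmult_0_r, exp_0, Rmult_1_r in A.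
  assert (B : W T * exp (k * T) <= W 0).
  { apply A; trivial. intros t Ht. specialize (Hd t Ht).
    assert (Hp := exp_pos (k * t)). nra. }
  replace (- k * T) with (- (k * T)) by ring. rewrite exp_Ropp.
  assert (Hp := exp_pos (k * T)).
  apply (Rmult_le_reg_r (exp (k * T))); trivial.
  rewrite Rmult_assoc, Rinv_l, Rmult_1_r by lra. exact B.
Qed.

(** The square makes the negative part differentiable across 0: for
    q y = (min y 0)^2 the first-order Taylor remainder is at most h^2. *)
Lemma D_in_sq_negative_part x dx t :
  D_in x dx half_line t ->
  D_in (fun s => Rmin (x s) 0 ^ 2) (fun s => dx s * (2 * Rmin (x s) 0))
       half_line t.
Proof.
  intros H.
  assert (A : D_in (fun y => Rmin y 0 ^ 2) (fun y => 2 * Rmin y 0) no_cond (x t)).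
  { apply derivable_pt_lim_D_in. intros eps Heps.
    exists (mkposreal eps Heps). simpl. intros h Hh Hlt.
    apply Rle_lt_trans with (Rabs h); trivial.
    set (y := x t).
    replace (_ / h - _) with
      ((Rmin (y + h) 0 ^ 2 - Rmin y 0 ^ 2 - 2 * Rmin y 0 * h) / h)
      by (field; trivial).
    rewrite Rabs_div by trivial.
    assert (0 < Rabs h) by now apply Rabs_pos_lt.
    apply Rle_div_l; trivial.
    replace (Rabs h * Rabs h) with (h * h)
      by (rewrite <- Rabs_mult, Rabs_pos_eq; nra).
    apply Rabs_le. unfold Rmin.
    repeat destruct Rle_dec; split; nra. }
  assert (B := Dcomp _ _ _ _ _ _ _ H A). cbv beta in B.
  apply (D_in_imp _ _ _ _ t) with (2 := B). intros s Hs. split; easy.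
Qed.

(** The square of the negative part of x satisfies a linear differential
    inequality with bounded coefficient on [0, T] and vanishes at 0. *)
Lemma nonneg_of_linear_inequality x dx g dg :
  (forall t, 0 <= t -> D_in x dx half_line t) ->
  (forall t, 0 <= t -> D_in g dg half_line t) ->
  (forall t, 0 <= t -> 0 <= dx t + g t * x t) ->
  0 <= x 0 -> forall t, 0 <= t -> 0 <= x t.
Proof.
  intros Hx Hg Hineq H0 T HT.
  destruct (continuity_ab_min (fun s => g (Rmax 0 s)) 0 T HT) as (s0 & Hmin & _).
  { intros s _. now apply (continuity_half_line_extension g dg). }
  set (m := g (Rmax 0 s0)) in *.
  assert (A : Rmin (x T) 0 ^ 2 <= Rmin (x 0) 0 ^ 2 * exp (- (2 * m) * T)).
  { apply (gronwall_half_line _ _ (2 * m) T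
      (fun t Ht => D_in_sq_negative_part x dx t (Hx t Ht))); trivial.
    intros t Ht. specialize (Hineq t (proj1 Ht)). specialize (Hmin t Ht).
    rewrite (Rmax_right 0 t) in Hmin by lra.
    unfold Rmin. destruct Rle_dec as [h|h]; [|lra].
    assert (x t * (dx t + g t * x t) <= 0) by nra.
    assert (m * x t ^ 2 <= g t * x t ^ 2)
      by (apply Rmult_le_compat_r; [apply pow2_ge_0 | lra]).
    lra. }
  rewrite (Rmin_right (x 0)) in A by lra.
  revert A. unfold Rmin. destruct Rle_dec as [h|h]; intros A; nra.
Qed.

(** * Solutions *)

Lemma D_in_eq f df g dg D t :
  (forall s, f s = g s) -> df t = dg t -> D_in f df D t -> D_in g dg D t.
Proof.
  intros Hfg Hd H eps Heps. destruct (H eps Heps) as (d & Hd0 & Hc).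
  exists d. split; trivial. intros s Hs. rewrite <- !Hfg, <- Hd. now apply Hc.
Qed.

Lemma D_in_energy (x dx : nat -> R -> R) N t :
  (forall j, D_in (x j) (dx j) half_line t) ->
  D_in (fun s => energy (fun j => x j s) N)
       (fun s => 2 * sum_f_R0 (fun j => x j s * dx j s) N) half_line t.
Proof.
  intros H. unfold energy.
  assert (Hsq : forall j, D_in (fun s => x j s ^ 2)
                  (fun s => 2 * (x j s * dx j s)) half_line t).
  { intros j. eapply D_in_eq; [| |exact (Dmult _ _ _ _ _ _ (H j) (H j))];
      intros; cbv beta; ring. }
  induction N as [|N IH].
  - exact (Hsq O).
  - eapply D_in_eq; [| |exact (Dadd _ _ _ _ _ _ IH (Hsq (S N)))];
      intros; cbv beta; rewrite ?tech5; ring.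
Qed.

Lemma solution_derivative c nu f a :
  is_solution c nu f a -> forall j t, 0 <= t ->
  D_in (fun s => a s j) (fun s => f j - dyadic_terms c nu (a s) j) half_line t.
Proof.
  intros [_ H] j t Ht. destruct (H j) as (da & Hda & Heq).
  apply (D_in_eq (fun s => a s j) da); trivial.
  - specialize (Heq t Ht). lra.
  - now apply Hda.
Qed.

(** Each mode solves a linear equation with coefficient P^j a_{j+1} + nu 4^j,
    driven by the nonnegative quantity P^{j-1} a_{j-1}^2 + f_j, whatever
    the signs of the other modes. *)
Lemma solution_nonneg c nu f a :
  (forall j, 0 <= f j) -> is_solution c nu f a -> (forall j, 0 <= a 0 j) ->
  forall t, 0 <= t -> forall j, 0 <= a t j.
Proof.
  intros Hf Hsol H0 t Ht j.
  assert (Hder := solution_derivative c nu f a Hsol).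
  assert (Hp : forall k, 0 <= Rpower 2 c ^ k)
    by (intros k; apply pow_le, Rlt_le, exp_pos).
  set (P := Rpower 2 c) in *.
  assert (Hg : forall s, 0 <= s -> D_in (fun r => P ^ j * a r (S j) + nu * 4 ^ j)
    (fun r => P ^ j * (f (S j) - dyadic_terms c nu (a r) (S j)) + 0) half_line s).
  { intros s Hs. apply Dadd; [apply Dmult_const, Hder, Hs | apply Dconst]. }
  apply (nonneg_of_linear_inequality (fun s => a s j) _ _ _ (Hder j) Hg); trivial.
  intros s Hs. specialize (Hf j). destruct j as [|j].
  - rewrite dyadic_terms_O. simpl. lra.
  - rewrite dyadic_terms_S. fold P.
    assert (0 <= P ^ j * a s j ^ 2)
      by (apply Rmult_le_pos; [apply Hp | apply pow2_ge_0]).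
    lra.
Qed.

Lemma energy_lim u :
  in_l2 u -> is_lim_seq (energy u) (l2_norm_sq u).
Proof.
  intros H. apply (is_lim_seq_ext (sum_n (fun j => u j ^ 2))).
  - intros n. apply sum_n_Reals.
  - exact (Series_correct _ H).
Qed.

Lemma energy_le_l2_norm_sq u N : in_l2 u -> energy u N <= l2_norm_sq u.
Proof.
  intros H. apply (is_lim_seq_incr_compare _ _ (energy_lim u H)).
  intros n. unfold energy. rewrite tech5.
  assert (h := pow2_ge_0 (u (S n))). lra.
Qed.

Lemma in_l2_minus u v : in_l2 u -> in_l2 v -> in_l2 (fun j => u j - v j).
Proof.
  intros Hu Hv. unfold in_l2 in *.
  apply (@ex_series_le R_AbsRing R_CompleteNormedModule _
           (fun j => 2 * u j ^ 2 + 2 * v j ^ 2)).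
  - intros j. change (Rabs ((u j - v j) ^ 2) <= 2 * u j ^ 2 + 2 * v j ^ 2).
    assert (h := pow2_ge_0 (u j + v j)).
    rewrite Rabs_pos_eq by apply pow2_ge_0. lra.
  - apply (ex_series_plus (fun j => 2 * u j ^ 2) (fun j => 2 * v j ^ 2)).
    + exact (ex_series_scal_l 2 _ Hu).
    + exact (ex_series_scal_l 2 _ Hv).
Qed.

(** The enstrophy bound gives 2^N alpha_N <= sqrt (F alpha_0 / nu), and
    P^N = (P/8)^N 4^N 2^N. *)
Lemma coupling_geometric P nu F alpha :
  0 < P -> 0 < nu -> positive_fixed_point P nu F alpha ->
  forall N, P ^ N * alpha N <= sqrt (F * alpha O / nu) * (P / 8) ^ N * 4 ^ N.
Proof.
  intros HP Hn Hfp N.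
  assert (HC := fixed_point_enstrophy P nu F alpha HP Hn Hfp N).
  destruct Hfp as (Hpos & _).
  assert (H2 : 0 < 2 ^ N) by (apply pow_lt; lra).
  assert (H42 : 4 ^ N = 2 ^ N * 2 ^ N)
    by (rewrite <- Rpow_mult_distr; f_equal; ring).
  assert (A : 4 ^ N * alpha N ^ 2 <= enstrophy alpha N).
  { destruct N as [|N]; [unfold enstrophy; simpl; lra|].
    unfold enstrophy. rewrite tech5.
    assert (h := enstrophy_nonneg alpha N). unfold enstrophy in h. lra. }
  assert (B : 2 ^ N * alpha N <= sqrt (F * alpha O / nu)).
  { rewrite <- (sqrt_Rsqr (2 ^ N * alpha N)).
    - apply sqrt_le_1_alt. apply (Rle_div_r _ _ nu Hn). unfold Rsqr.
      apply Rle_trans with (2 := HC).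
      replace (_ * _ * nu) with (nu * (4 ^ N * alpha N ^ 2))
        by (rewrite H42; ring).
      apply Rmult_le_compat_l; lra.
    - apply Rlt_le, Rmult_lt_0_compat; trivial. }
  assert (E : P ^ N = (P / 8) ^ N * 4 ^ N * 2 ^ N)
    by (rewrite <- !Rpow_mult_distr; f_equal; field).
  assert (Hr : 0 <= (P / 8) ^ N * 4 ^ N).
  { apply Rmult_le_pos; apply pow_le; lra. }
  rewrite E at 1.
  replace (sqrt (F * alpha O / nu) * (P / 8) ^ N * 4 ^ N)
    with ((P / 8) ^ N * 4 ^ N * sqrt (F * alpha O / nu)) by ring.
  rewrite (Rmult_assoc _ (2 ^ N)). now apply Rmult_le_compat_l.
Qed.

(** The constant K depends on everything but N: it collects the initial energy
    of the solution, weighted by delta_N, and the level m of order eps_N under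
    which the functional stops decreasing. *)
Lemma truncated_decay c nu f alpha a :
  0 < nu -> 0 <= c ->
  0 < f O -> (forall j, (0 < j)%nat -> f j = 0) -> in_l2 alpha ->
  positive_fixed_point (Rpower 2 c) nu (f O) alpha ->
  is_solution c nu f a -> in_l2 (a 0) -> (forall j, 0 <= a 0 j) ->
  forall t, 0 <= t ->
  exists K, forall N,
    energy (fun j => a t j - alpha j) N
    <= energy (fun j => a 0 j - alpha j) N * exp (- (2 * / 21 * nu) * t)
       + K * (Rpower 2 c / 8) ^ N.
Proof.
  intros Hn Hc HF Hf Hl Hfp Hsol Hl0 H0 T HT.
  assert (Hu : forall t, 0 <= t -> forall j, 0 <= a t j).
  { apply (solution_nonneg c nu f); trivial. intros [|j]; [lra|].
    rewrite Hf by lia. lra. }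
  assert (Hder := solution_derivative c nu f a Hsol).
  assert (HP : 1 <= Rpower 2 c) by (rewrite <- (Rpower_O 2) by lra; apply Rle_Rpower; lra).
  set (P := Rpower 2 c) in *.
  set (C := f O * alpha O / nu).
  set (s := sqrt C).
  set (M := 6 * C / nu + 12 * f O ^ 2 / nu ^ 3).
  set (A0 := l2_norm_sq (a 0)).
  exists (24 * s / nu * A0 + 21 * s * M). intros N.
  set (r := (P / 8) ^ N).
  set (delta := 24 * (s * r) / nu).
  set (m := 21 * (s * r) * M).
  assert (Hr : 0 <= r) by (apply pow_le; lra).
  assert (Hs : 0 <= s) by apply sqrt_pos.
  assert (Hsr : 0 <= s * r) by now apply Rmult_le_pos.
  assert (Hinv : 0 < / nu) by now apply Rinv_0_lt_compat.
  assert (Hd : 0 <= delta) by (unfold delta, Rdiv; apply Rmult_le_pos; lra).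
  assert (HC : 0 <= C).
  { unfold C, Rdiv. destruct Hfp as [Hpos _]. specialize (Hpos O).
    apply Rmult_le_pos; [nra | lra]. }
  assert (HM : 0 <= M).
  { unfold M, Rdiv. apply Rplus_le_le_0_compat; apply Rmult_le_pos; try lra.
    - apply Rmult_le_pos; [lra | apply pow2_ge_0].
    - apply Rlt_le, Rinv_0_lt_compat, pow_lt, Hn. }
  assert (Hm : 0 <= m) by (unfold m; apply Rmult_le_pos; lra).
  assert (G : forall t, 0 <= t ->
     2 * sum_f_R0 (fun j => (a t j - alpha j)
                     * ((f j - dyadic_terms c nu (a t) j) - 0)) N
     + delta * (2 * sum_f_R0 (fun j => a t j * (f j - dyadic_terms c nu (a t) j)) (S N))
     - 0
     <= - (2 * / 21 * nu) * (energy (fun j => a t j - alpha j) N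
          + delta * energy (a t) (S N) - m)).
  { intros t Ht. rewrite Rminus_0_r.
    rewrite (sum_eq _ (fun j => (a t j - alpha j)
               * (f j - dyadic_terms c nu (a t) j)) N)
      by (intros j _; ring).
    apply (truncated_lyapunov_decay P nu (f O)); trivial.
    - exact (Hu t Ht).
    - rewrite dyadic_terms_O. ring.
    - intros j. rewrite Hf, dyadic_terms_S by lia. fold P. ring.
    - apply (coupling_geometric P nu (f O)); trivial. lra.
    - unfold C. apply (Rle_div_r _ _ nu Hn). rewrite Rmult_comm.
      apply (fixed_point_enstrophy P); trivial. lra. }
  assert (D : forall t, 0 <= t ->
    D_in (fun s => energy (fun j => a s j - alpha j) N
                   + delta * energy (fun j => a s j) (S N) - m)
     (fun t => 2 * sum_f_R0 (fun j => (a t j - alpha j)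
                     * ((f j - dyadic_terms c nu (a t) j) - 0)) N
     + delta * (2 * sum_f_R0 (fun j => a t j * (f j - dyadic_terms c nu (a t) j)) (S N))
     - 0) half_line t).
  { intros t Ht. apply Dminus; [apply Dadd | apply Dconst].
    - apply (D_in_energy (fun j s => a s j - alpha j)
        (fun j s => f j - dyadic_terms c nu (a s) j - 0)).
      intros j. apply Dminus; [now apply Hder | apply Dconst].
    - apply Dmult_const.
      apply (D_in_energy (fun j s => a s j)
        (fun j s => f j - dyadic_terms c nu (a s) j)).
      intros j. now apply Hder. }
  (* Gronwall for the functional shifted by m, so that no inhomogeneous term
     remains. *)
  assert (W := gronwall_half_line _ _ (2 * / 21 * nu) T D
    (fun t Ht => G t (proj1 Ht)) HT).
  cbv beta in W. clear G D.
  assert (HA : energy (a 0) (S N) <= A0) by now apply energy_le_l2_norm_sq.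
  assert (HE0 : forall u n, 0 <= energy u n)
    by (intros u n; apply cond_pos_sum; intros j; apply pow2_ge_0).
  assert (HEa := HE0 (a T) (S N)). assert (HEa0 := HE0 (a 0) (S N)).
  change (fun j => a T j) with (a T) in W. change (fun j => a 0 j) with (a 0) in W.
  set (e := exp (- (2 * / 21 * nu) * T)) in *.
  assert (He : 0 < e <= 1).
  { split; [apply exp_pos|]. unfold e. rewrite <- exp_0.
    apply Rnot_lt_le. intros h. apply exp_lt_inv in h. nra. }
  assert (F1 : 0 <= delta * energy (a T) (S N)) by now apply Rmult_le_pos.
  assert (F2 : delta * energy (a 0) (S N) * e <= delta * A0).
  { assert (delta * energy (a 0) (S N) <= delta * A0)
      by now apply Rmult_le_compat_l.
    assert (0 <= delta * energy (a 0) (S N)) by now apply Rmult_le_pos. nra. }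
  assert (F3 : 0 <= m * e) by (apply Rmult_le_pos; lra).
  replace ((24 * s / nu * A0 + 21 * s * M) * r) with (delta * A0 + m)
    by (unfold delta, m; field; lra).
  lra.
Qed.

Theorem theorem3p4 (c : R) (hc : 3 / 2 < c <= 5 / 2) :
  exists gamma : R, 0 < gamma < 1 /\
    forall (nu : R) (f alpha : nat -> R) (a : R -> nat -> R),
      0 < nu ->
      0 < f O ->
      (forall j : nat, (0 < j)%nat -> f j = 0) ->
      is_fixed_point c nu f alpha ->
      (2 < c -> forall j : nat, 0 <= alpha j) ->
      is_solution c nu f a ->
      in_l2 (a 0) ->
      (forall j : nat, 0 <= a 0 j) ->
      forall t : R, 0 <= t ->
        l2_norm_sq (fun j => a t j - alpha j)
        <= l2_norm_sq (fun j => a 0 j - alpha j) * exp (- 2 * gamma * nu * t).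
Proof.
  exists (/ 21). split; [lra|].
  intros nu f alpha a Hn HF Hf Hfix Hsign Hsol Hl0 H0 t Ht.
  assert (HP1 : 1 <= Rpower 2 c)
    by (rewrite <- (Rpower_O 2) by lra; apply Rle_Rpower; lra).
  assert (HP8 : Rpower 2 c < 8).
  { replace 8 with (2 ^ 3) by ring. rewrite <- Rpower_pow by lra.
    apply Rpower_lt; simpl; lra. }
  assert (Hl := proj1 Hfix).
  destruct (fixed_point_relations c nu f alpha Hfix Hf) as [R0 RS].
  assert (Hfp : positive_fixed_point (Rpower 2 c) nu (f O) alpha).
  { apply fixed_point_positive; trivial.
    intros H4. apply Hsign. apply Rnot_le_lt. intros Hle.
    apply (Rlt_irrefl 4), (Rlt_le_trans _ _ _ H4).
    replace 4 with (2 ^ 2) by ring. rewrite <- Rpower_pow by lra.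
    apply Rle_Rpower; simpl; lra. }
  destruct (truncated_decay c nu f alpha a) with (t := t) as [K HK]; trivial; [lra|].
  replace (- 2 * / 21 * nu * t) with (- (2 * / 21 * nu) * t) by ring.
  set (e := exp (- (2 * / 21 * nu) * t)) in *.
  set (b0 := l2_norm_sq (fun j => a 0 j - alpha j)).
  assert (L : is_lim_seq (fun N => energy (fun j => a 0 j - alpha j) N * e
                + K * (Rpower 2 c / 8) ^ N) (b0 * e + K * 0)).
  { apply is_lim_seq_plus'.
    - apply (is_lim_seq_scal_r _ e (Finite b0)), energy_lim, in_l2_minus; trivial.
    - apply (is_lim_seq_scal_l _ K (Finite 0)), is_lim_seq_geom.
      rewrite Rabs_pos_eq; lra. }
  assert (E := is_lim_seq_le _ _ _ _ HK
    (energy_lim _ (in_l2_minus _ _ (proj1 Hsol t Ht) Hl)) L).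
  simpl in E. lra.
Qed.
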